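(* Let $R$ be an associative ring with identity $1$ and a non-trivial idempotent $e$, put $e_1=e$, $e_2=1-e$, $R_{ij}=e_iRe_j$ for $i,j\in\{1,2\}$, and assume that for all $i,j,k\in\{1,2\}$ and every $a_{ij}\in R_{ij}$: if $a_{ij}x_{jk}=0$ for all $x_{jk}\in R_{jk}$, then $a_{ij}=0$. Let $\varphi:R\to R$ be a multiplicative automorphism of $R$, let $D:R\to R$ be a map satisfying $D(ab)=D(a)b+\varphi(a)D(b)$ for all $a,b\in R$, and let $g:R\to R$ be a multiplicative generalized skew derivation associated with $\varphi$ and $D$, i.e. a map satisfying $g(ab)=g(a)b+\varphi(a)D(b)$ for all $a,b\in R$. Then $g$ is additive. Moreover, $g$ is a generalized skew derivation on $R$.
   Context: Rings are associative and not assumed commutative. A non-trivial idempotent is an element $e$ with $e^2=e$, $e\neq 0$, $e\neq 1$. A map $f:R\to R$ is additive if $f(a+b)=f(a)+f(b)$ for all $a,b\in R$. A multiplicative automorphism of $R$ is a bijective map $\varphi:R\to R$ with $\varphi(ab)=\varphi(a)\varphi(b)$ for all $a,b\in R$ (additivity not assumed); an automorphism is an additive multiplicative automorphism. A skew derivation is an additive map $D:R\to R$ with $D(ab)=D(a)b+\varphi(a)D(b)$ for all $a,b\in R$, where $\varphi$ is an automorphism. A generalized skew derivation is an additive map $g:R\to R$ with $g(ab)=g(a)b+\varphi(a)D(b)$ for all $a,b\in R$, where $\varphi$ is an automorphism of $R$ and $D$ is a skew derivation (with respect to $\varphi$). No additivity is assumed of $\varphi$, $D$ or $g$ in the hypotheses.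 *)

(* Defs.v *)
From mathcomp Require Import all_boot all_algebra.
Set Implicit Arguments. Unset Strict Implicit. Unset Printing Implicit Defensive.
Import GRing.Theory.
Local Open Scope ring_scope.

Definition nontrivial_idempotent (R : pzRingType) (e : R) : Prop :=
  [/\ e * e = e, e <> 0 & e <> 1].

(* The index set {1, 2} is encoded as {0, 1} = 'I_2: e_1 = e, e_2 = 1 - e. *)
Definition peirce_idem (R : pzRingType) (e : R) (i : 'I_2) : R :=
  if i == ord0 then e else 1 - e.

(* The Peirce component R_ij = e_i R e_j. *)
Definition peirce (R : pzRingType) (e : R) (i j : 'I_2) (x : R) : Prop :=
  exists r : R, x = peirce_idem e i * r * peirce_idem e j.

Definition additive_map (R : pzRingType) (f : R -> R) : Prop :=
  {morph f : a b / a + b}.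

Definition multiplicative_automorphism (R : pzRingType) (phi : R -> R) : Prop :=
  bijective phi /\ {morph phi : a b / a * b}.

Definition ring_automorphism (R : pzRingType) (phi : R -> R) : Prop :=
  multiplicative_automorphism phi /\ additive_map phi.

(* g (a b) = g(a) b + phi(a) D(b); taking g = D gives the skew Leibniz rule. *)
Definition skew_rule (R : pzRingType) (phi D g : R -> R) : Prop :=
  forall a b : R, g (a * b) = g a * b + phi a * D b.

Definition skew_derivation (R : pzRingType) (phi D : R -> R) : Prop :=
  [/\ ring_automorphism phi, additive_map D & skew_rule phi D D].

(* Relative to the associated maps phi and D, so additivity of phi and of D is
   part of the notion. *)
Definition generalized_skew_derivation (R : pzRingType) (phi D g : R -> R) : Prop :=
  [/\ ring_automorphism phi, skew_derivation phi D, additive_map g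
    & skew_rule phi D g].

(* Main.v *)
Require Import Defs.
From mathcomp Require Import all_boot all_algebra.
Set Implicit Arguments. Unset Strict Implicit. Unset Printing Implicit Defensive.
Import GRing.Theory.
Local Open Scope ring_scope.

(** The argument is Martindale's. Off the diagonal, additivity of a multiplicative
    map F comes from (e1 + a12) (b12 + e2) = a12 + b12; everywhere else, the
    defect F (a + b) - F a - F b is killed by multiplying it, on either side, by
    values of F. Run first for F = phi, then for the
    multiplicative map x |-> [[phi x, D x], [0, x]] into 2 x 2 matrices, this
    makes phi and D additive. Finally phi 1 = 1, so g x = g 1 * x + D x. *)

Definition defect (R S : pzRingType) (F : R -> S) (a b : R) : S :=
  F (a + b) - F a - F b.

Lemma defect_eq0 (R S : pzRingType) (F : R -> S) a b :
  defect F a b = 0 <-> F (a + b) = F a + F b.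
Proof.
rewrite /defect -addrA -opprD; split; last by move=> ->; rewrite subrr.
by move/eqP; rewrite subr_eq0 => /eqP.
Qed.

Lemma defect0r (R S : pzRingType) (F : R -> S) a : F 0 = 0 -> defect F a 0 = 0.
Proof. by move=> F0; apply/defect_eq0; rewrite F0 !addr0. Qed.

Lemma defect0l (R S : pzRingType) (F : R -> S) a : F 0 = 0 -> defect F 0 a = 0.
Proof. by move=> F0; apply/defect_eq0; rewrite F0 !add0r. Qed.

Lemma defectMr (R S : pzRingType) (F : R -> S) a b x :
  {morph F : u v / u * v} -> defect F a b * F x = defect F (a * x) (b * x).
Proof. by move=> FM; rewrite /defect !mulrBl -!FM mulrDl. Qed.

Lemma defectMl (R S : pzRingType) (F : R -> S) a b x :
  {morph F : u v / u * v} -> F x * defect F a b = defect F (x * a) (x * b).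
Proof. by move=> FM; rewrite /defect !mulrBr -!FM mulrDr. Qed.

Definition orthogonal_idempotents (R : pzRingType) (p q : R) : Prop :=
  [/\ p * p = p, q * q = q, p * q = 0 & q * p = 0].

Lemma orthogonal_idempotentsC (R : pzRingType) (p q : R) :
  orthogonal_idempotents p q -> orthogonal_idempotents q p.
Proof. by case. Qed.

(** Cancellation is asked of defects only: for [skew_mx] these have a single entry, so it reduces to
    a statement in [R]. *)
Definition defect_faithfull (R S : pzRingType) (F : R -> S) (p q : R) : Prop :=
  forall a b, F p * defect F a b = 0 -> F q * defect F a b = 0 ->
  defect F a b = 0.

(** On the right, the test by [F p] is replaced by tests on the corner [p R q], since this is what
    the Peirce hypothesis provides. *)
Definition defect_faithfulr (R S : pzRingType) (F : R -> S) (p q : R) : Prop :=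
  forall a b, (forall x, defect F a b * F (p * x * q) = 0) ->
  defect F a b * F q = 0 -> defect F a b = 0.

(** Each test multiplier annihilates one of the two arguments, and a defect with a zero argument
    vanishes. *)
Lemma defect_columns (R S : pzRingType) (F : R -> S) p q u v :
  {morph F : a b / a * b} -> F 0 = 0 -> orthogonal_idempotents p q ->
  defect_faithfulr F p q -> defect F (u * p) (v * q) = 0.
Proof.
move=> FM F0 [pp qq pq qp] Fr; apply: Fr => [x|].
- rewrite defectMr // [v * q * _]mulrA [v * q * _]mulrA -(mulrA v) qp mulr0.
  by rewrite !mul0r defect0r.
- by rewrite defectMr // -(mulrA u) pq mulr0 defect0l.
Qed.

Lemma defect_rows (R S : pzRingType) (F : R -> S) p q u v :
  {morph F : a b / a * b} -> F 0 = 0 -> orthogonal_idempotents p q ->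
  defect_faithfull F p q -> defect F (p * u) (q * v) = 0.
Proof.
move=> FM F0 [pp qq pq qp] Fl; apply: Fl.
- by rewrite defectMl // [p * (q * v)]mulrA pq mul0r defect0r.
- by rewrite defectMl // mulrA qp mul0r defect0l.
Qed.

Lemma defect_off_diagonal (R S : pzRingType) (F : R -> S) p q a b :
  {morph F : u v / u * v} -> F 0 = 0 -> orthogonal_idempotents p q ->
  defect_faithfull F p q -> defect_faithfulr F p q ->
  defect F (p * a * q) (p * b * q) = 0.
Proof.
move=> FM F0 pqI Fl Fr; case: (pqI) => pp qq pq qp.
(* Writing [p * p] and [q * q] for the idempotents puts the left factor in the form of
   [defect_columns] and the right one in that of [defect_rows]. *)
have sumE : p * a * q + p * b * q = (p * p + p * a * q) * (p * (b * q) + q * q).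
  rewrite pp qq mulrDl !mulrDr pq addr0 [p * (p * _)]mulrA pp.
  by rewrite -(mulrA (p * a)) [q * (p * _)]mulrA qp mul0r mulr0 add0r
             -(mulrA (p * a)) qq addrC -[p * b * q]mulrA.
apply/defect_eq0; rewrite sumE FM.
move/defect_eq0: (defect_columns p (p * a) FM F0 pqI Fr) => ->.
move/defect_eq0: (defect_rows (b * q) q FM F0 pqI Fl) => ->.
(* The same expansion now takes place in [S]: both cross terms are [F 0]. *)
rewrite mulrDl !mulrDr -!FM pp qq pq F0 addr0 [p * (p * _)]mulrA pp.
rewrite -(mulrA (p * a)) [q * (p * _)]mulrA qp mul0r mulr0 F0 add0r.
by rewrite -(mulrA (p * a)) qq addrC mulrA.
Qed.

(** Right multiplication by [F (p * x * q)] moves the defect into the off-diagonal corner; [F q]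
    sends both arguments to 0. *)
Lemma defect_diagonal (R S : pzRingType) (F : R -> S) p q a b :
  {morph F : u v / u * v} -> F 0 = 0 -> orthogonal_idempotents p q ->
  defect_faithfull F p q -> defect_faithfulr F p q ->
  defect F (p * a * p) (p * b * p) = 0.
Proof.
move=> FM F0 pqI Fl Fr; case: (pqI) => pp qq pq qp; apply: (Fr) => [x|].
- have assocE c : p * c * p * (p * x * q) = p * (c * p * p * x) * q.
    by rewrite !mulrA.
  by rewrite defectMr // !assocE defect_off_diagonal.
- by rewrite defectMr // -!(mulrA _ p) pq !mulr0 defect0r.
Qed.

Lemma multiplicative_map_additive (R S : pzRingType) (F : R -> S) p q :
  {morph F : u v / u * v} -> F 0 = 0 -> orthogonal_idempotents p q ->
  defect_faithfull F p q -> defect_faithfulr F p q -> defect_faithfulr F q p ->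
  {morph F : a b / a + b}.
Proof.
move=> FM F0 pqI Fl Frpq Frqp a b; apply/defect_eq0.
have Fl' : defect_faithfull F q p by move=> u v ? ?; apply: Fl.
(* Left multiplication by [F p] and [F q] splits the column [R q] into an off-diagonal and a
   diagonal corner. Both right tests then carry arbitrary arguments into this column. *)
have column u v : defect F (u * q) (v * q) = 0.
  apply: (Fl); rewrite defectMl // !mulrA.
  - exact: defect_off_diagonal.
  - exact: (defect_diagonal _ _ FM F0 (orthogonal_idempotentsC pqI) Fl' Frqp).
by apply: Frpq => [x|]; rewrite defectMr // ?[_ * (_ * q)]mulrA column.
Qed.

(* [d] ranges over all of R, not over a single Peirce component. *)
Definition corner_faithful (R : pzRingType) (p q : R) : Prop :=
  forall d : R, (forall x, d * (p * x * q) = 0) -> d * q = 0 -> d = 0.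

(** Since [d] kills the [k] column, it is the sum over [i] of its components in the [j] column, to
    each of which the Peirce hypothesis applies. *)
Lemma peirce_corner_faithful (R : pzRingType) (e : R) (j k : 'I_2) :
  (forall (i : 'I_2) (a : R), peirce e i j a ->
     (forall x : R, peirce e j k x -> a * x = 0) -> a = 0) ->
  peirce_idem e j + peirce_idem e k = 1 ->
  peirce_idem e j * peirce_idem e j = peirce_idem e j ->
  corner_faithful (peirce_idem e j) (peirce_idem e k).
Proof.
move=> hR jk1 jj d dx dk.
have comp0 i : peirce_idem e i * d * peirce_idem e j = 0.
  apply: (hR i) => [|_ [r ->]]; first by exists d.
  rewrite -(mulrA (_ * d)) [peirce_idem e j * (_ * _)]mulrA.
  by rewrite [peirce_idem e j * (_ * _)]mulrA jj -(mulrA (_ i)) dx mulr0.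
have sum1 : peirce_idem e ord0 + peirce_idem e ord_max = 1.
  by rewrite /peirce_idem /= subrKC.
rewrite -[d]mulr1 -jk1 mulrDr dk addr0 -[d]mul1r -sum1 2!mulrDl.
by rewrite !comp0 addr0.
Qed.

(** By surjectivity 1 is a value of [phi], and [phi 1] acts as an identity on values. *)
Lemma multiplicative_automorphism1 (R : pzRingType) (phi : R -> R) :
  multiplicative_automorphism phi -> phi 1 = 1.
Proof.
by case=> -[psi _ psiK] phiM; rewrite -[LHS]mulr1 -{2}[1]psiK -phiM mul1r psiK.
Qed.

Lemma multiplicative_automorphism0 (R : pzRingType) (phi : R -> R) :
  multiplicative_automorphism phi -> phi 0 = 0.
Proof.
by case=> -[psi _ psiK] phiM; rewrite -[RHS](mulr0 (phi 0)) -{3}[0]psiK -phiM mul0r.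
Qed.

Lemma multiplicative_automorphism_additive (R : pzRingType) (p q : R)
    (phi : R -> R) :
  orthogonal_idempotents p q -> p + q = 1 ->
  corner_faithful p q -> corner_faithful q p ->
  multiplicative_automorphism phi -> additive_map phi.
Proof.
move=> pqI pq1 cpq cqp phiA.
have phi0 := multiplicative_automorphism0 phiA.
case: phiA => -[psi phiK psiK] phiM.
have phi_eq0 u : phi u = 0 -> u = 0.
  by move=> phiu; apply: (can_inj phiK); rewrite phi0.
(* The identity [phi p + phi q = 1] is not yet available, so defects are pulled back along [psi] and
   cancelled in [R]. *)
have faithfulr r s : corner_faithful r s -> defect_faithfulr phi r s.
  move=> crs a b; rewrite -[defect phi a b]psiK => dx ds.
  rewrite [psi _]crs // => [x|]; apply: phi_eq0; rewrite phiM //.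
apply: (multiplicative_map_additive phiM phi0 pqI); try exact: faithfulr.
move=> a b; rewrite -[defect phi a b]psiK -!phiM => /phi_eq0 dp /phi_eq0 dq.
by rewrite -[psi _]mul1r -pq1 mulrDl dp dq addr0.
Qed.

Definition skew_mx (R : pzRingType) (phi D : R -> R) (x : R) : 'M[R]_2 :=
  \matrix_(i, j) if i == ord0 then if j == ord0 then phi x else D x
                 else if j == ord0 then 0 else x.

(** The upper right entry of the product is [phi a * D b + D a * b], which is the skew rule. *)
Lemma skew_mxM (R : pzRingType) (phi D : R -> R) :
  {morph phi : a b / a * b} -> skew_rule phi D D ->
  {morph skew_mx phi D : a b / a * b}.
Proof.
move=> phiM DM a b; apply/matrixP => i j; rewrite !mxE !big_ord_recl big_ord0.
rewrite !mxE /= addr0; case: (i == ord0); case: (j == ord0).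
- by rewrite mulr0 addr0 phiM.
- by rewrite DM addrC.
- by rewrite mul0r mulr0 addr0.
- by rewrite mul0r add0r.
Qed.

Lemma defect_skew_mx (R : pzRingType) (phi D : R -> R) (a b : R) :
  additive_map phi ->
  defect (skew_mx phi D) a b = defect D a b *: delta_mx ord0 ord_max.
Proof.
move=> phiD; apply/matrixP => i j; rewrite !mxE.
case: i => [[|[|//]] hi]; case: j => [[|[|//]] hj] //=.
- by rewrite mulr0; apply/defect_eq0/phiD.
- by rewrite mulr1.
- by rewrite mulr0 !subr0.
- by rewrite mulr0 addrAC addrK subrr.
Qed.

Lemma skew_rule_additive (R : pzRingType) (p q : R) (phi D : R -> R) :
  orthogonal_idempotents p q -> p + q = 1 ->
  corner_faithful p q -> corner_faithful q p ->
  ring_automorphism phi -> skew_rule phi D D -> additive_map D.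
Proof.
move=> pqI pq1 cpq cqp [phiA phiD] DM.
have phi0 := multiplicative_automorphism0 phiA.
have phi1 := multiplicative_automorphism1 phiA.
have D0 : D 0 = 0 by rewrite -[X in D X](mulr0 0) DM phi0 mul0r mulr0 addr0.
case: phiA => _ phiM; set F := skew_mx phi D.
have FM : {morph F : u v / u * v} by exact: skew_mxM.
have F0 : F 0 = 0.
  by apply/matrixP => i j; rewrite !mxE phi0 D0; do 2!case: ifP.
(* By triangularity, [F x] acts on the corner entry through [x] on the right and through [phi x] on
   the left. *)
have entryr a b x : (defect F a b * F x) ord0 ord_max = defect D a b * x.
  rewrite /F defect_skew_mx // mxE !big_ord_recl big_ord0 !mxE /=.
  by rewrite mulr0 mul0r add0r mulr1 addr0.
have entryl a b x : (F x * defect F a b) ord0 ord_max = phi x * defect D a b.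
  rewrite /F defect_skew_mx // mxE !big_ord_recl big_ord0 !mxE /=.
  by rewrite mulr1 !mulr0 !addr0.
have faithfulr r s : corner_faithful r s -> defect_faithfulr F r s.
  move=> crs a b dx ds; rewrite /F defect_skew_mx // [defect D a b]crs ?scale0r //.
  - by move=> x; rewrite -entryr dx mxE.
  - by rewrite -entryr ds mxE.
have FD : {morph F : a b / a + b}.
  apply: (multiplicative_map_additive FM F0 pqI); try exact: faithfulr.
  (* Additivity of [phi] gives [1 = phi 1 = phi p + phi q], so the two left tests add up to the
     defect itself. *)
  move=> a b dp dq; rewrite /F defect_skew_mx // -[defect D a b]mul1r -phi1 -pq1.
  by rewrite phiD mulrDl -!entryl dp dq !mxE addr0 scale0r.
by move=> a b; have /matrixP/(_ ord0 ord_max) := FD a b; rewrite !mxE.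
Qed.

Theorem theorem4p1 (R : pzRingType) (e : R)
  (he : nontrivial_idempotent e)
  (hR : forall (i j k : 'I_2) (a : R), peirce e i j a ->
      (forall x : R, peirce e j k x -> a * x = 0) -> a = 0)
  (phi D g : R -> R)
  (hphi : multiplicative_automorphism phi)
  (hD : forall a b : R, D (a * b) = D a * b + phi a * D b)
  (hg : forall a b : R, g (a * b) = g a * b + phi a * D b) :
  additive_map g /\ generalized_skew_derivation phi D g.
Proof.
case: he => ee _ _.
have ef : e * (1 - e) = 0 by rewrite mulrBr mulr1 ee subrr.
have fe : (1 - e) * e = 0 by rewrite mulrBl mul1r ee subrr.
have ff : (1 - e) * (1 - e) = 1 - e by rewrite mulrBr mulr1 fe subr0.
have efI : orthogonal_idempotents e (1 - e) by split.
have ef1 : e + (1 - e) = 1 by rewrite subrKC.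
have cef : corner_faithful e (1 - e).
  by apply: (@peirce_corner_faithful _ e ord0 ord_max) => // i; apply: hR.
have cfe : corner_faithful (1 - e) e.
  apply: (@peirce_corner_faithful _ e ord_max ord0) => [i||//]; first exact: hR.
  by rewrite addrC.
have phiD : additive_map phi.
  exact: (multiplicative_automorphism_additive efI).
have DD : additive_map D by exact: (skew_rule_additive efI _ _ _ (conj hphi phiD)).
have gE a : g a = g 1 * a + D a.
  by rewrite -[X in g X]mul1r hg (multiplicative_automorphism1 hphi) mul1r.
have gD : additive_map g.
  by move=> a b; rewrite gE [g a]gE [g b]gE DD mulrDr addrACA.
by split=> //; split.
Qed.
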